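(* Let $k\ge2$ be a fixed integer. Then $\gamma_k(c)$ is a piecewise polynomial function of $c$ on $[0,k]$. Specifically, for each integer $r$ with $0\le r\le k-1$ there is a polynomial $p_r$ such that $\gamma_k(c)=p_r(c)$ for all $r\le c<r+1$, and each time $c$ passes through an integer it becomes a different polynomial: $p_r\neq p_{r-1}$ for every integer $1\le r\le k-1$.
   Context: The function $\gamma_k$ is $$\gamma_k(c)=\frac{1}{k!\,G(1+k)^2}\int_{[0,1]^k}\delta_c(w_1+\cdots+w_k)\prod_{i<j}(w_i-w_j)^2\,d^kw,$$ where $\delta_c(x)=\delta(x-c)$ is the delta distribution translated by $c$, and $G$ is the Barnes $G$-function, so $G(1+k)=1!\cdot2!\cdots(k-1)!$. Concretely, the integral means the integral of $\prod_{1\le i<j\le k}(w_i-w_j)^2$ with $w_k:=c-w_1-\cdots-w_{k-1}$, with respect to Lebesgue measure $dw_1\cdots dw_{k-1}$ over the set of $(w_1,\dots,w_{k-1})\in[0,1]^{k-1}$ for which $0\le w_k\le1$. *)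

(* Defs.v *)
From HB Require Import structures.
From mathcomp Require Import all_boot all_order all_algebra.
From mathcomp Require Import all_classical all_reals all_analysis.

Set Implicit Arguments.
Unset Strict Implicit.
Unset Printing Implicit Defensive.
Import Order.TTheory GRing.Theory Num.Theory.

Local Open Scope classical_set_scope.
Local Open Scope ring_scope.

(* Lebesgue measure on R^n, the points of R^n being the n-tuples, with the
   product sigma-algebra. It is built by transporting the product measure on
   R * R^n to R^(n+1) along [tuple_cons]; the measure of a box is computed in
   [lebesgue_tuple_box]. *)
Section LebesgueTuple.
Context {R : realType}.
Let mR : measurableType _ := measurableTypeR R.

Definition tuple_cons n (p : mR * n.-tuple mR) : n.+1.-tuple mR :=
  [the n.+1.-tuple mR of p.1 :: p.2].

Lemma measurable_tuple_cons n :
  measurable_fun [set: mR * n.-tuple mR] (@tuple_cons n).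
Proof. exact: (measurable_cons measurable_fst measurable_snd). Qed.

Section LebesgueCons.
Variables (n : nat) (m : {sigma_finite_measure set (n.-tuple mR) -> \bar R}).

Definition lebesgue_cons : set (n.+1.-tuple mR) -> \bar R :=
  pushforward (@lebesgue_measure R \x m)%E (@tuple_cons n).

Let measurable_preimage_tuple_cons A :
  measurable A -> measurable (@tuple_cons n @^-1` A).
Proof.
by move=> mA; rewrite -[X in measurable X]setTI; exact: measurable_tuple_cons.
Qed.

Let lebesgue_cons0 : lebesgue_cons set0 = 0%E.
Proof. by rewrite /lebesgue_cons /pushforward preimage_set0 measure0. Qed.

Let lebesgue_cons_ge0 A : (0 <= lebesgue_cons A)%E.
Proof. by rewrite /lebesgue_cons /pushforward; exact: measure_ge0. Qed.

Let lebesgue_cons_sigma_additive : semi_sigma_additive lebesgue_cons.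
Proof.
move=> F mF tF mUF; rewrite /lebesgue_cons /pushforward preimage_bigcup.
apply: measure_semi_sigma_additive.
- by move=> i; exact: measurable_preimage_tuple_cons.
- apply/trivIsetP => /= i j _ _ ij; rewrite -preimage_setI.
  by move/trivIsetP : tF => /(_ _ _ _ _ ij) ->//; rewrite preimage_set0.
- by rewrite -preimage_bigcup; exact: measurable_preimage_tuple_cons.
Qed.

HB.instance Definition _ := isMeasure.Build _ _ _ lebesgue_cons
  lebesgue_cons0 lebesgue_cons_ge0 lebesgue_cons_sigma_additive.

Let lebesgue_cons_sigma_finite : sigma_finite setT lebesgue_cons.
Proof.
have [F TF Foo] : sigma_finite setT (@lebesgue_measure R \x m)%E.
  have /sigma_finiteP[A [TA ndA Aoo]] := sigma_finiteT (@lebesgue_measure R).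
  have /sigma_finiteP[B [TB ndB Boo]] := sigma_finiteT m.
  exists (fun i => A i `*` B i).
    rewrite -setXTT TA TB predeqE => -[x y]; split.
      move=> [/= [i _ Aix] [j _ Bjy]]; exists (maxn i j) => //; split.
      - by move: x Aix; exact/subsetPset/ndA/leq_maxl.
      - by move: y Bjy; exact/subsetPset/ndB/leq_maxr.
    by move=> [i _ []/= ? ?]; split; exists i.
  move=> i; have [? ?] := Aoo i; have [? ?] := Boo i.
  split; first exact: measurableX.
  by rewrite product_measure1E// lte_mul_pinfty// ge0_fin_numE.
pose g (t : n.+1.-tuple mR) : mR * n.-tuple mR :=
  (thead t, [tuple of behead t]).
have mg : measurable_fun setT g.
  apply/measurable_fun_pairP; split; first exact: measurable_tnth.
  exact: measurable_behead.
have gK : cancel (@tuple_cons n) g.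
  by move=> [x t]; rewrite /g /tuple_cons; congr pair; exact: val_inj.
exists (fun i => g @^-1` F i).
  by rewrite -preimage_bigcup -TF preimage_setT.
move=> i; have [mFi Fioo] := Foo i; split.
  by rewrite -[X in measurable X]setTI; exact: mg.
rewrite /lebesgue_cons /pushforward -comp_preimage.
by rewrite (_ : g \o _ = id) //; apply/funext => p; exact: gK.
Qed.

HB.instance Definition _ := Measure_isSigmaFinite.Build _ _ _ lebesgue_cons
  lebesgue_cons_sigma_finite.

End LebesgueCons.

Fixpoint lebesgue_tuple n : {sigma_finite_measure set (n.-tuple mR) -> \bar R} :=
  match n with
  | 0 => \d_([tuple] : 0.-tuple mR)
  | n'.+1 => lebesgue_cons (lebesgue_tuple n')
  end.

Lemma lebesgue_tuple_box n (A : 'I_n -> set mR) :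
  (forall i, measurable (A i)) ->
  (lebesgue_tuple n [set t | forall i, A i (tnth t i)]
   = \prod_(i < n) lebesgue_measure (A i))%E.
Proof.
elim: n A => [|n IHn] A mA.
  rewrite big_ord0 /= diracE mem_set //; by case.
rewrite big_ord_recl -IHn // -product_measure1E //; last first.
  pose B i := (fun t : n.-tuple mR => tnth t i) @^-1` A (lift ord0 i).
  rewrite (_ : [set t | _] = \bigcap_(i in [set: 'I_n]) B i).
    apply: fin_bigcap_measurable => // i _; rewrite /B.
    by rewrite -[X in measurable X]setTI; exact: measurable_tnth.
  by apply/seteqP; split => t /= h i; [move=> _; exact: (h i)|exact: (h i I)].
rewrite /= /lebesgue_cons /pushforward; congr (_ _).
apply/seteqP; split => -[x t] /= h.
  split; first exact: (h ord0).
  by move=> i; have := h (lift ord0 i); rewrite tnthS.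
move=> i; case: (unliftP ord0 i) => [j ->|->]; last by case: h.
by rewrite tnthS; case: h => _; exact.
Qed.

End LebesgueTuple.

(* G(n) for a natural number n: G(0) = 0 and G(1 + m) = 1! 2! ... (m - 1)!. *)
Definition barnesG (n : nat) : nat :=
  if n is m.+1 then \prod_(1 <= i < m) i`! else 0.

Section Gamma.
Context {R : realType}.

Definition sq_vandermonde k (w : k.-tuple R) : R :=
  \prod_(i < k) \prod_(j < k | (i < j)%N) (tnth w i - tnth w j) ^+ 2.

Section Slice.
Variables (n : nat) (c : R).
Implicit Type w : n.-tuple (measurableTypeR R).

Definition last_coord w : R := c - \sum_(i < n) (tnth w i : R).

Definition complete_tuple w : n.+1.-tuple R :=
  [tuple of rcons w (last_coord w)].

Definition cube_slice : set (n.-tuple (measurableTypeR R)) :=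
  [set w | (forall i, 0 <= (tnth w i : R) <= 1) /\ 0 <= last_coord w <= 1].

End Slice.

(* The variables of integration are w_1, ..., w_(k-1); meant for k >= 1 (for
   k = 0 the truncated predecessor gives a meaningless value). *)
Definition gamma (k : nat) (c : R) : R :=
  ((k`! * barnesG (1 + k) ^ 2)%N%:R)^-1 *
  \int[lebesgue_tuple k.-1]_(w in cube_slice c)
    sq_vandermonde (complete_tuple c w).

End Gamma.

(* Main.v *)
Require Import Defs.
From HB Require Import structures.
From mathcomp Require Import all_boot all_order all_algebra.
From mathcomp Require Import all_classical all_reals all_analysis.
From mathcomp Require Import measurable_realfun.
From mathcomp Require Import -(notations) mpoly.
From mathcomp Require Import zify ring lra.

(** Each coordinate of the cube satisfies [0 <= x <= 1], and the indicator
    function of that condition is the difference of the indicator functions of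
    the rays [0 <= x] and [1 < x]. Multiplying out over the coordinates writes
    the cube as an alternating sum, over the sets S of coordinates, of
    translated orthants: the coordinates in S exceed 1 and the other ones are
    nonnegative ([cube_slice_expansion]).

    On the orthant attached to S the squared Vandermonde product is a
    polynomial in the differences between the coordinates and those of the
    vertex of the orthant. The integral of one monomial over the slice of
    total mass c is an iterated convolution of truncated powers, and the Beta
    integral ([convolution_truncated_power]) shows that it is a nonnegative
    multiple of a power of the positive part of c - |S|
    ([slice_integral_prod]); as k >= 2, there is a variable of integration, so
    that the exponent is positive. Adding up the monomials, the contribution
    of S is 0 for c < |S| and a polynomial P_S of c for |S| <= c
    ([orthant_integral]). Hence gamma_k(c) is, up to a positive constant, the
    sum of (-1)^|S| P_S(c) over the S with |S| <= c ([gamma_orthants]), which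
    gives one polynomial on each interval [r, r + 1).

    When c passes through r, the polynomial changes by (-1)^r times the sum of
    the P_S with |S| = r, so all the contributions to one jump have the same
    sign and cannot cancel. They are not zero either: for c large, P_S(c) is
    the integral of a nonnegative function which is at least 1 on some box of
    volume 1 ([orthant_polynomial_ge1]). *)

Set Implicit Arguments.
Unset Strict Implicit.
Unset Printing Implicit Defensive.
Import Order.TTheory GRing.Theory Num.Theory.
Import numFieldNormedType.Exports.

Local Open Scope ring_scope.

(** * Convolution of truncated powers *)

Section Convolution.
Context {R : realType}.
Implicit Types (a b c k t x : R) (g : R -> R) (m l : nat).

Lemma integral_deriv (p : {poly R}) a b : a < b ->
  (\int[lebesgue_measure]_(x in `[a, b]%classic) (p^`().[x])%:E
   = (p.[b] - p.[a])%:E)%E.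
Proof.
move=> ab; rewrite (@continuous_FTC2 _ _ (horner p)) //.
- by apply: continuous_subspaceT => x; exact: continuous_horner.
- split; first by move=> x _; exact: derivable_horner.
  + by apply: cvg_at_right_filter; exact: continuous_horner.
  + by apply: cvg_at_left_filter; exact: continuous_horner.
- by move=> x _; rewrite derivE.
Qed.

(** The term-by-term antiderivative of the binomial expansion of
    x^m (t - x)^l; it vanishes at 0. *)
Definition beta_primitive m l t : {poly R} :=
  \sum_(i < l.+1) (((-1) ^+ i * t ^+ (l - i)) *+ 'C(l, i)
         / (m + i).+1%:R) *: 'X^((m + i).+1).

Lemma deriv_beta_primitive m l t :
  (beta_primitive m l t)^`() = 'X^m * (t%:P - 'X) ^+ l.
Proof.
rewrite raddf_sum exprBn mulr_sumr; apply: eq_bigr => i _ /=.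
rewrite derivZ derivXn /= -scalerMnr scalerMnl.
rewrite -[_ *+ _.+1]mulr_natr divfK ?pnatr_eq0 //.
rewrite -[in RHS]mulrnAl -(rmorphN1 polyC) -!rmorphXn -rmorphM /= -rmorphMn /=.
by rewrite mulrCA -exprD mul_polyC.
Qed.

(** The Beta integral, up to the value of the constant. The exponent of t
    comes from homogeneity: it appears because every term of the antiderivative
    has total degree m + l + 1 in (x, t). The constant is nonnegative because
    it is the value of the integral for t = 1. *)
Lemma beta_integral m l : exists2 k, 0 <= k & forall a t, 0 < t ->
  (\int[lebesgue_measure]_(x in `[a, (a + t)%R]%classic)
      ((x - a) ^+ m * (t - (x - a)) ^+ l)%:E = (k * t ^+ (m + l).+1)%:E)%E.
Proof.
pose k := \sum_(i < l.+1) ((-1) ^+ i *+ 'C(l, i) / (m + i).+1%:R) : R.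
have beta_eq a t : 0 < t ->
  (\int[lebesgue_measure]_(x in `[a, (a + t)%R]%classic)
      ((x - a) ^+ m * (t - (x - a)) ^+ l)%:E = (k * t ^+ (m + l).+1)%:E)%E.
  move=> t0.
  have := integral_deriv (beta_primitive m l t \Po ('X - a%:P)) (_ : a < a + t).
  rewrite deriv_comp deriv_beta_primitive derivXsubC mulr1 ltrDl => /(_ t0).
  under eq_integral do rewrite horner_comp !hornerE.
  move=> ->; congr EFin; rewrite !horner_comp !hornerE addrAC subrr add0r.
  rewrite !horner_sum [X in _ - X]big1 ?subr0; last first.
    by move=> i _; rewrite !hornerE expr0n /= mulr0.
  rewrite mulr_suml; apply: eq_bigr => i _; rewrite !hornerE.
  have -> : (m + l).+1 = ((l - i) + (m + i).+1)%N by have := ltn_ord i; lia.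
  rewrite exprD -mulrnAl mulrA; congr (_ * _).
  by rewrite -[LHS]mulrA -[RHS]mulrA [_^-1 * _]mulrC.
exists k => //.
have := beta_eq 0 1 ltr01; rewrite expr1n mulr1 => kE.
rewrite -lee_fin -kE; apply: integral_ge0 => x /=.
rewrite in_itv /= add0r subr0 => /andP[x0 x1].
by rewrite lee_fin mulr_ge0 // exprn_ge0 // subr_ge0.
Qed.

(** The value at the threshold a is left free, so that the power truncated to
    [a <= x] and the one truncated to [a < x] are both covered: the expansion of
    the closed cube produces both kinds. *)
Definition truncated_power a m k g :=
  (forall x, x < a -> g x = 0) /\ (forall x, a < x -> g x = k * (x - a) ^+ m).

(** For m = 0 this is the constant 1 and not an indicator function; it is used
    with positive exponents, where it is continuous. *)
Definition pospow m x := Num.max 0 x ^+ m.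

Lemma pospow_truncated a m k :
  (0 < m)%N -> truncated_power a m k (fun x => k * pospow m (x - a)).
Proof.
move=> m0; split=> x xa; rewrite /pospow.
  by rewrite max_l ?expr0n ?gtn_eqF ?mulr0 // subr_le0 ltW.
by rewrite max_r // subr_ge0 ltW.
Qed.

(** A convolution does not see the values of the factors at their thresholds,
    and the resulting exponent is positive; so the value of the integral is
    unambiguous even at c = a + b. *)
Lemma convolution_truncated_power a b m l k k' g g' :
  truncated_power a m k g -> truncated_power b l k' g' ->
  0 <= k -> 0 <= k' ->
  exists2 K, 0 <= K & forall c,
    (\int[lebesgue_measure]_x (g x * g' (c - x))%:E
     = (K * pospow (m + l).+1 (c - (a + b)))%:E)%E.
Proof.
move=> [g0 gE] [g'0 g'E] k0 k'0; have [B B0 BE] := beta_integral m l.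
exists (k * k' * B) => [|c]; first by rewrite !mulr_ge0.
pose t := c - (a + b).
have -> : (\int[lebesgue_measure]_x (g x * g' (c - x))%:E =
  \int[lebesgue_measure]_(x in `[a, (a + t)%R]%classic)
    (g x * g' (c - x))%:E)%E.
  rewrite [RHS]integral_mkcond; apply: eq_integral => x _.
  rewrite patchE; case: ifPn => //; rewrite notin_setE /= in_itv /= /t.
  move/negP; rewrite negb_and -!ltNge => /orP[xa|xt].
    by rewrite g0 // mul0r.
  by rewrite (g'0 (c - x)) ?mulr0 //; lra.
have [t0|t0] := leP t 0.
  (* The supports of the two factors share at most one point. *)
  rewrite /pospow max_l // expr0n mulr0 /=.
  have [t0'|t0'] := ltP t 0.
    by rewrite set_itv_ge ?integral_set0 // bnd_simp -ltNge; lra.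
  have -> : a + t = a by lra.
  by rewrite set_itv1 integral_set1.
have eqf : {in `]a, (a + t)%R[%classic, forall x, (g x * g' (c - x))%:E =
   ((k * k') * ((x - a) ^+ m * (t - (x - a)) ^+ l))%:E}.
  move=> x; rewrite inE /= in_itv /= /t => /andP[xa xb].
  rewrite gE // g'E; last by lra.
  congr EFin; rewrite mulrACA; congr (_ * (_ * _ ^+ _)); lra.
have mf : measurable_fun setT
    (fun x : R => (x - a) ^+ m * (t - (x - a)) ^+ l).
  apply: measurable_funM; apply: measurable_funX; first exact: measurable_funB.
  by apply: measurable_funB => //; exact: measurable_funB.
have mkf : measurable_fun `]a, (a + t)%R[%classic
    (EFin \o (fun x : R => (k * k') * ((x - a) ^+ m * (t - (x - a)) ^+ l))).
  apply/measurable_EFinP; apply: measurable_funM => //.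
  exact: measurable_funTS.
rewrite integral_itv_bndoo; last first.
  by apply: eq_measurable_fun mkf => x /eqf.
transitivity (\int[lebesgue_measure]_(x in `]a, (a + t)%R[%classic)
    ((k * k') * ((x - a) ^+ m * (t - (x - a)) ^+ l))%:E)%E.
  by apply: eq_integral => x /eqf.
rewrite -(integral_itv_bndoo true false) //=.
under eq_integral do rewrite EFinM.
rewrite ge0_integralZl //; first last.
- by rewrite lee_fin mulr_ge0.
- move=> x /=; rewrite in_itv /= => /andP[xa xb]; rewrite lee_fin.
  by rewrite mulr_ge0 // exprn_ge0 //; lra.
- exact/measurable_EFinP/measurable_funTS.
by rewrite BE // /pospow max_r ?ltW // -EFinM mulrA.
Qed.

End Convolution.

(** * Integrals over slices as iterated convolutions *)

Section Slices.
Context {R : realType}.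
Local Notation mR := (measurableTypeR R).

(** Tonelli's theorem, separating the first coordinate. *)
Lemma ge0_integral_lebesgue_tupleS n (f : n.+1.-tuple mR -> \bar R) :
  measurable_fun setT f -> (forall w, (0 <= f w)%E) ->
  (\int[lebesgue_tuple n.+1]_w f w
   = \int[lebesgue_measure]_x \int[lebesgue_tuple n]_w f (tuple_cons (x, w)))%E.
Proof.
move=> mf f0.
have mt := @measurable_tuple_cons R n.
transitivity (\int[(@lebesgue_measure R \x lebesgue_tuple n)%E]_z
    (f \o @tuple_cons R n) z)%E.
  transitivity (\int[pushforward (@lebesgue_measure R \x lebesgue_tuple n)%E
    (@tuple_cons R n)]_(w in setT) f w)%E; first exact: eq_measure_integral.
  by rewrite (ge0_integral_pushforward mt) ?preimage_setT.
rewrite fubini_tonelli1 //; last by move=> x; exact: f0.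
exact: (measurableT_comp mf mt).
Qed.

(** Integrating out the first coordinate x leaves a slice of the same kind, at
    level c - x: this is why slice integrals are iterated convolutions. *)
Lemma complete_tuple_cons n (c x : R) (w : n.-tuple mR) :
  complete_tuple c (tuple_cons (x, w))
  = [tuple of x :: complete_tuple (c - x) w].
Proof.
apply: val_inj; rewrite /= /last_coord; congr (_ :: rcons _ _).
rewrite big_ord_recl opprD addrA; congr (_ - _ - _).
by apply: eq_bigr => i _; rewrite tnthS.
Qed.

Lemma measurable_last_coord n (c : R) :
  measurable_fun setT (last_coord c : n.-tuple mR -> R).
Proof.
apply: measurable_funB => //; apply: measurable_sum => i.
exact: measurable_tnth.
Qed.

Lemma tnth_complete_tuple_widen n (c : R) (w : n.-tuple mR) (i : 'I_n) :
  tnth (complete_tuple c w) (widen_ord (leqnSn n) i) = tnth w i.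
Proof. by rewrite !(tnth_nth 0) /= nth_rcons size_tuple ltn_ord. Qed.

Lemma tnth_complete_tuple_max n (c : R) (w : n.-tuple mR) :
  tnth (complete_tuple c w) ord_max = last_coord c w.
Proof. by rewrite (tnth_nth 0) /= nth_rcons size_tuple ltnn eqxx. Qed.

Lemma measurable_complete_tuple n (c : R) (i : 'I_n.+1) :
  measurable_fun setT (fun w : n.-tuple mR => tnth (complete_tuple c w) i).
Proof.
have [->|i_lt] := eqVneq i ord_max.
  by under eq_fun do rewrite tnth_complete_tuple_max;
    exact: measurable_last_coord.
have i_n : (i < n)%N by rewrite ltn_neqAle -ltnS ltn_ord andbT.
have -> : i = widen_ord (leqnSn n) (Ordinal i_n) by exact: val_inj.
under eq_fun do rewrite tnth_complete_tuple_widen.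
exact: measurable_tnth.
Qed.

(** A Dirichlet integral, up to the value of the constant. In dimension 0 no
    integration takes place and the value of J at the threshold is that of
    [g ord0], whence the weak first description of J, which is what the
    induction carries; the closed formula holds as soon as there is one
    variable of integration. *)
Lemma slice_integral_prod n (g : 'I_n.+1 -> R -> R) (a : 'I_n.+1 -> R)
    (m : 'I_n.+1 -> nat) :
  (forall i, measurable_fun setT (g i)) -> (forall i x, 0 <= g i x) ->
  (forall i, truncated_power (a i) (m i) 1 (g i)) ->
  exists J, [/\ forall c, (\int[lebesgue_tuple n]_w
        (\prod_i g i (tnth (complete_tuple c w) i))%:E = (J c)%:E)%E,
      exists M, exists2 k, 0 <= k & truncated_power (\sum_i a i) M k J
    & (0 < n)%N -> exists M k,
        forall c, J c = k * pospow M.+1 (c - \sum_i a i)].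
Proof.
elim: n => [|n IHn] in g a m * => mg g0 gE.
  exists (g ord0); split=> // [c|].
    transitivity (\int[\d_([tuple] : 0.-tuple mR)]_(w in setT)
      (g ord0 (last_coord c w))%:E)%E.
      apply: eq_integral => w _.
      rewrite big_ord1 (_ : ord0 = ord_max); last exact: val_inj.
      by rewrite tnth_complete_tuple_max.
    rewrite integral_dirac //; last first.
      apply/measurable_EFinP; apply: measurableT_comp => //.
      exact: measurable_last_coord.
    by rewrite diracT mul1e /last_coord big_ord0 subr0.
  by exists (m ord0), 1 => //; rewrite big_ord1.
have [J [JE [M [k k0 kE]] _]] := IHn (g \o lift ord0) (a \o lift ord0)
  (m \o lift ord0) (fun i => mg _) (fun i => g0 _) (fun i => gE _).
have [K K0 KE] := convolution_truncated_power (gE ord0) kE ler01 k0.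
exists (fun c => K * pospow (m ord0 + M).+1 (c - \sum_i a i)); split.
- move=> c; rewrite ge0_integral_lebesgue_tupleS; first last.
  + by move=> w; rewrite lee_fin prodr_ge0.
  + apply/measurable_EFinP/measurable_prod => i _.
    by apply: measurableT_comp => //; exact: measurable_complete_tuple.
  rewrite big_ord_recl -KE; apply: eq_integral => x _.
  rewrite EFinM -JE -ge0_integralZl //; first last.
  + by rewrite lee_fin.
  + by move=> w _; rewrite lee_fin prodr_ge0 // => i _; exact: g0.
  + apply/measurable_EFinP/measurable_prod => i _.
    by apply: (measurableT_comp (mg (lift ord0 i)));
      exact: measurable_complete_tuple.
  apply: eq_integral => w _; rewrite -EFinM complete_tuple_cons big_ord_recl.
  by congr (_ * _)%:E; apply: eq_bigr => i _; rewrite tnthS.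
- by exists (m ord0 + M).+1, K => //; exact: pospow_truncated.
- by move=> _; exists (m ord0 + M)%N, K.
Qed.

(** * Linear combinations of integrals *)

(** Integrability is kept together with the value because the integrals to be
    added up have coefficients of both signs. *)
Definition has_integral d (T : measurableType d)
    (mu : {measure set T -> \bar R}) (f : T -> R) (v : R) :=
  mu.-integrable setT (EFin \o f) /\ (\int[mu]_x (f x)%:E = v%:E)%E.

Lemma has_integral_lincomb d (T : measurableType d)
    (mu : {measure set T -> \bar R}) (I : Type) (s : seq I) (b : I -> R)
    (f : I -> T -> R) (v : I -> R) :
  (forall i, has_integral mu (f i) (v i)) ->
  has_integral mu (fun x => \sum_(i <- s) b i * f i x)
    (\sum_(i <- s) b i * v i).
Proof.
move=> fv.
have bf i : mu.-integrable setT (fun x => (b i)%:E * (f i x)%:E)%E.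
  by apply: integrableZl => //; have [] := fv i.
have E x : (\sum_(i <- s) b i * f i x)%:E
    = (\sum_(i <- s) (b i)%:E * (f i x)%:E)%E.
  by rewrite -sumEFin; apply: eq_bigr => i _; rewrite EFinM.
have IE : (\int[mu]_x (\sum_(i <- s) b i * f i x)%:E
    = \int[mu]_x \sum_(i <- s) (b i)%:E * (f i x)%:E)%E.
  by apply: eq_integral => x _; exact: E.
split.
  rewrite (_ : EFin \o _ = fun x => \sum_(i <- s) (b i)%:E * (f i x)%:E)%E.
    exact: integrable_sum.
  by apply/funext => x; exact: E.
rewrite IE integral_sum // -sumEFin; apply: eq_bigr => i _.
have [fi fE] := fv i; by rewrite EFinM -fE integralZl.
Qed.

Lemma ge0_has_integral d (T : measurableType d)
    (mu : {measure set T -> \bar R}) (f : T -> R) (v : R) :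
  measurable_fun setT f -> (forall x, 0 <= f x) ->
  (\int[mu]_x (f x)%:E = v%:E)%E -> has_integral mu f v.
Proof.
move=> mf f0 fv; split=> //; apply/integrableP; split.
  exact/measurable_EFinP.
under eq_integral do rewrite /= ger0_norm //.
by rewrite fv ltry.
Qed.

(** * Orthants *)

(** The ray above 1 is open and the ray above 0 is closed, so that their
    difference is the closed unit interval with no exceptional point. *)
Definition ray (b : bool) (x : R) : R := (if b then 1 < x else 0 <= x)%R%:R.

Lemma ray_diff x : ray false x - ray true x = (0 <= x <= 1)%R%:R.
Proof.
rewrite /ray; case: ltP => [x1|x1]; rewrite ?andbF ?andbT /= ?subr0 //.
by rewrite (le_trans _ (ltW x1)) // subrr.
Qed.

Lemma measurable_ray b : measurable_fun setT (ray b).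
Proof.
have -> : ray b = \1_(if b then `]1, +oo[%classic else `[0, +oo[%classic).
  apply/funext => x; rewrite /ray indicE; congr (nat_of_bool _)%:R.
  by case: b; rewrite mem_setE in_itv /= andbT.
by apply: measurable_indic; case: b; exact: measurable_itv.
Qed.

Lemma ray_truncated_power (b : bool) m :
  truncated_power (b%:R : R) m 1 (fun x => ray b x * (x - b%:R) ^+ m).
Proof.
split=> x; rewrite /ray; case: b => /= xb.
- by rewrite ltNge ltW // mul0r.
- by rewrite leNgt xb mul0r.
- by rewrite xb.
- by rewrite ltW.
Qed.

Lemma ray_power_ge0 (b : bool) m x : 0 <= ray b x * (x - b%:R) ^+ m.
Proof.
rewrite /ray; case: b => /=.
  by case: (ltP 1 x) => x1; rewrite ?mul0r //= mul1r exprn_ge0 // subr_ge0 ltW.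
by case: (leP 0 x) => x0; rewrite ?mul0r //= mul1r exprn_ge0 // subr0.
Qed.

(** The coordinates i with [S i] exceed 1 and the other ones are nonnegative;
    the vertex of this orthant is the indicator vector of S, and q is expanded
    in monomials around that vertex so that each monomial splits into truncated
    powers. *)
Lemma orthant_integral n (S : 'I_n.+1 -> bool) (q : mpoly n.+1 R) : (0 < n)%N ->
  exists P : {poly R}, forall c : R, has_integral (lebesgue_tuple n)
    (fun w => \prod_i ray (S i) (tnth (complete_tuple c w) i)
       * meval (fun i => tnth (complete_tuple c w) i - (S i)%:R) q)
    (if (\sum_i S i)%N%:R <= c then P.[c] else 0).
Proof.
move=> n0.
have /choice[P PE] : forall m : multinom n.+1, exists P : {poly R}, forall c,
    has_integral (lebesgue_tuple n)
      (fun w => \prod_i (ray (S i) (tnth (complete_tuple c w) i)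
         * (tnth (complete_tuple c w) i - (S i)%:R) ^+ m i))
      (if (\sum_i S i)%N%:R <= c then P.[c] else 0).
  move=> m.
  pose g i x := ray (S i) x * (x - (S i)%:R) ^+ m i.
  have mg i : measurable_fun setT (g i).
    apply: measurable_funM; first exact: measurable_ray.
    by apply: measurable_funX; exact: measurable_funB.
  have [J [JE _ /(_ n0)[M [k Jk]]]] := slice_integral_prod mg
    (fun i => ray_power_ge0 _ _) (fun i => ray_truncated_power _ _).
  exists (k *: ('X - (\sum_i S i)%N%:R%:P) ^+ M.+1) => c.
  apply: ge0_has_integral.
  - apply: measurable_prod => i _; apply: measurableT_comp (mg i) _.
    exact: measurable_complete_tuple.
  - by move=> w; rewrite prodr_ge0 // => i _; exact: ray_power_ge0.
  rewrite JE Jk; congr EFin; rewrite -natr_sum /pospow.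
  case: leP => [Sc|cS]; first by rewrite !hornerE max_r // subr_ge0.
  by rewrite max_l ?expr0n ?mulr0 // subr_le0 ltW.
exists (\sum_(m <- msupp q) mcoeff m q *: P m) => c.
have := has_integral_lincomb (msupp q) (fun m => mcoeff m q) (fun m => PE m c).
congr has_integral.
  apply/funext => w; rewrite mevalE mulr_sumr; apply: eq_bigr => m _.
  by rewrite big_split /= mulrCA.
rewrite horner_sum; case: ifP => _; last first.
  by rewrite big1 // => m _; rewrite mulr0.
by apply: eq_bigr => m _; rewrite hornerZ.
Qed.

(** Expanding around an arbitrary point a lets the monomials be adapted to the
    vertex of each orthant. *)
Lemma sq_vandermonde_meval k (a : 'I_k -> R) :
  exists q : mpoly k R, forall w : k.-tuple R,
    sq_vandermonde w = meval (fun i => tnth w i - a i) q.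
Proof.
exists (\prod_(i < k) \prod_(j < k | (i < j)%N)
  (mpolyX R (mnm1 i) - mpolyX R (mnm1 j) + mpolyC k (a i - a j)) ^+ 2) => w.
rewrite rmorph_prod; apply: eq_bigr => i _ /=.
rewrite rmorph_prod; apply: eq_bigr => j _ /=.
rewrite rmorphXn /= rmorphD rmorphB /= !mevalXU mevalC.
by congr (_ ^+ 2); ring.
Qed.

Definition orthant_density n (S : {ffun 'I_n.+1 -> bool}) (c : R)
    (w : n.-tuple mR) : R :=
  \prod_i ray (S i) (tnth (complete_tuple c w) i)
  * sq_vandermonde (complete_tuple c w).

(** The number of elements of S is the sum of the coordinates of the vertex of
    the orthant, hence the level below which no slice meets the orthant. *)
Definition orthant_level n (S : {ffun 'I_n.+1 -> bool}) : nat := (\sum_i S i)%N.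

Lemma orthant_polynomials n : (0 < n)%N ->
  exists P : {ffun 'I_n.+1 -> bool} -> {poly R}, forall S c,
    has_integral (lebesgue_tuple n) (orthant_density S c)
      (if (orthant_level S)%:R <= c then (P S).[c] else 0).
Proof.
move=> n0.
suff /choice[P PE] : forall S : {ffun 'I_n.+1 -> bool}, exists P : {poly R},
    forall c, has_integral (lebesgue_tuple n) (orthant_density S c)
      (if (orthant_level S)%:R <= c then P.[c] else 0) by exists P.
move=> S; have [q qE] := sq_vandermonde_meval (fun i => (S i)%:R).
have [P PE] := orthant_integral S q n0; exists P => c.
by have := PE c; congr has_integral; apply/funext => w; rewrite -qE.
Qed.

(** * The cube as an alternating sum of orthants *)

Lemma mem_cube_slice n (c : R) (w : n.-tuple mR) :
  (w \in cube_slice c)%:R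
  = \prod_(i < n.+1) (ray false (tnth (complete_tuple c w) i)
                    - ray true (tnth (complete_tuple c w) i)) :> R.
Proof.
under eq_bigr do rewrite ray_diff.
rewrite -natr_prod; congr (_%:R).
rewrite big_ord_recr /= tnth_complete_tuple_max.
under eq_bigr do rewrite tnth_complete_tuple_widen.
have [wc|wc] := boolP (w \in _).
  move: wc; rewrite inE => -[wi wl].
  by rewrite wl big1 // => i _; rewrite wi.
move: wc; rewrite notin_setE /cube_slice /= => /not_andP[wi|/negP/negbTE -> ].
  have /existsNP[i /negP/negbTE wi'] := wi.
  by rewrite (bigD1 i) //= wi'.
by rewrite muln0.
Qed.

(** The product over the coordinates of the differences of the two rays, one
    term for each choice of a ray at every coordinate. *)
Lemma cube_slice_expansion n (c : R) (w : n.-tuple mR) :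
  (w \in cube_slice c)%:R * sq_vandermonde (complete_tuple c w)
  = \sum_(S : {ffun 'I_n.+1 -> bool})
      (-1) ^+ orthant_level S * orthant_density S c w.
Proof.
rewrite mem_cube_slice.
rewrite (eq_bigr (fun i => \sum_(b : bool)
    (-1) ^+ b * ray b (tnth (complete_tuple c w) i))); last first.
  by move=> i _; rewrite big_bool /= mulN1r mul1r addrC.
rewrite bigA_distr_bigA /= mulr_suml; apply: eq_bigr => S _.
by rewrite big_split /= prodrXr mulrA.
Qed.

Lemma gamma_orthants n (P : {ffun 'I_n.+1 -> bool} -> {poly R}) (c : R) :
  (forall S, has_integral (lebesgue_tuple n) (orthant_density S c)
      (if (orthant_level S)%:R <= c then (P S).[c] else 0)) ->
  gamma n.+1 c = ((n.+1`! * barnesG (1 + n.+1) ^ 2)%N%:R)^-1 *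
    \sum_(S | (orthant_level S)%:R <= c) (-1) ^+ orthant_level S * (P S).[c].
Proof.
move=> PE; rewrite /gamma; congr (_ * _).
have [_ IE] := has_integral_lincomb (index_enum _)
  (fun S => (-1) ^+ orthant_level S) PE.
rewrite /Rintegral integral_mkcond /=.
rewrite (_ : (\int[_]_x _ x)%E = (\int[lebesgue_tuple n]_w
  (\sum_(S : {ffun 'I_n.+1 -> bool})
      (-1) ^+ orthant_level S * orthant_density S c w)%:E)%E); last first.
  apply: eq_integral => w _; rewrite -cube_slice_expansion patchE.
  by case: ifP => _; rewrite ?mul1r ?mul0r.
rewrite IE /= [RHS]big_mkcond; apply: eq_bigr => S _.
by case: ifP => //; rewrite mulr0.
Qed.

(** * Positivity of the jumps *)

(** The intervals of the box are at distance at least 1 from each other, so the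
    differences of the first n coordinates are at least 1 in absolute value.
    The level is the sum of all the upper ends 2 i + 3 for i <= n, which keeps
    the last coordinate at or above 2 n + 3, hence away from the other ones. All
    coordinates exceed 1, so the same box works for every S. *)
Lemma orthant_density_ge1 n (S : {ffun 'I_n.+1 -> bool}) (w : n.-tuple mR) :
  (forall i : 'I_n, (2 * i + 2)%:R <= (tnth w i : R) <= (2 * i + 3)%:R) ->
  1 <= orthant_density S (\sum_(i < n.+1) (2 * i + 3)%:R) w.
Proof.
move=> wE; set c := \sum_(i < _) _; pose v := tnth (complete_tuple c w).
have v_ge (i : 'I_n.+1) : (2 * i + 2)%:R <= v i.
  rewrite /v; have [->|i_lt] := eqVneq i ord_max.
    rewrite tnth_complete_tuple_max /last_coord /c big_ord_recr /=.
    rewrite addrAC -sumrB ler_wpDl //.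
      by apply: sumr_ge0 => j _; rewrite subr_ge0; case/andP: (wE j).
    by rewrite ler_nat; lia.
  have i_n : (i < n)%N by rewrite ltn_neqAle -ltnS ltn_ord andbT.
  rewrite (_ : i = widen_ord (leqnSn n) (Ordinal i_n)); last exact: val_inj.
  by rewrite tnth_complete_tuple_widen; case/andP: (wE (Ordinal i_n)).
have v_le (i j : 'I_n.+1) : (i < j)%N -> v i <= (2 * i + 3)%:R.
  move=> ij; have i_n : (i < n)%N by rewrite (leq_trans ij) // -ltnS.
  rewrite /v (_ : i = widen_ord (leqnSn n) (Ordinal i_n)); last exact: val_inj.
  by rewrite tnth_complete_tuple_widen; case/andP: (wE (Ordinal i_n)).
have v_gt1 i : 1 < v i by apply: lt_le_trans (v_ge i); rewrite ltr1n; lia.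
rewrite /orthant_density big1 ?mul1r => [|i _]; last first.
  by rewrite /ray -/(v i) v_gt1 (le_trans ler01 (ltW (v_gt1 i))) if_same.
rewrite /sq_vandermonde.
have ge1_prod (I : finType) (Q : pred I) (F : I -> R) :
    (forall i, Q i -> 1 <= F i) -> 1 <= \prod_(i | Q i) F i.
  by move=> F1; apply: (big_ind (fun y => 1 <= y)) => // x y; exact: mulr_ege1.
apply: (ge1_prod _ _ _) => i _; apply: ge1_prod => j ij.
rewrite -/(v i) -/(v j) -sqrrN opprB; apply: exprn_ege1.
have gap : (2 * i + 3)%:R + 1 <= (2 * j + 2)%:R :> R.
  by rewrite natr1 ler_nat; lia.
by rewrite lerBrDl (le_trans _ (v_ge j)) // (le_trans _ gap) //
  lerD2r (v_le _ _ ij).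
Qed.

(** The integral is at least the volume of the box of [orthant_density_ge1],
    which is 1. *)
Lemma orthant_polynomial_ge1 n (S : {ffun 'I_n.+1 -> bool}) (v : R) :
  has_integral (lebesgue_tuple n)
    (orthant_density S (\sum_(i < n.+1) (2 * i + 3)%:R)) v -> 1 <= v.
Proof.
set c := \sum_(i < _) _ => -[/integrableP[mf _] vE].
pose B (i : 'I_n) : set mR := `[(2 * i + 2)%:R, (2 * i + 3)%:R]%classic.
pose box := [set t : n.-tuple mR | forall i, B i (tnth t i)]%classic.
have mB i : measurable (B i) by exact: measurable_itv.
have mbox : measurable box.
  rewrite (_ : box = \bigcap_(i in [set: 'I_n])
      ((fun t => tnth t i) @^-1` B i))%classic.
    apply: fin_bigcap_measurable => // i _.
    by rewrite -[X in measurable X]setTI; exact: measurable_tnth.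
  by apply/seteqP; split => t /= h i; [move=> _; exact: (h i)|exact: (h i I)].
have box1 : (lebesgue_tuple n box = 1)%E.
  rewrite lebesgue_tuple_box // big1 // => i _.
  rewrite /B lebesgue_measure_itv /= lte_fin ltr_nat ifT; last by lia.
  by rewrite -EFinB -natrB; [rewrite (_ : (_ - _)%N = 1%N) //; lia | lia].
rewrite -lee_fin -vE -box1 -(setIT box) -integral_indic //.
apply: ge0_le_integral => //.
  by apply/measurable_EFinP; exact: measurable_indic.
move=> w _; rewrite lee_fin indicE; have [wB|_] := boolP (w \in box).
  apply: orthant_density_ge1 => i; move: wB; rewrite inE => /(_ i).
  by rewrite /B /= in_itv.
rewrite /orthant_density mulr_ge0 //.
  by apply: prodr_ge0 => i _; rewrite /ray ler0n.
by apply: prodr_ge0 => i _; apply: prodr_ge0 => j _; exact: sqr_ge0.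
Qed.

Lemma orthant_level_surj n r : (r <= n.+1)%N ->
  exists S : {ffun 'I_n.+1 -> bool}, orthant_level S = r.
Proof.
move=> rn; exists [ffun i : 'I_n.+1 => (i < r)%N]; rewrite /orthant_level.
transitivity (\sum_(i < n.+1 | (i < r)%N) 1)%N; last first.
  by rewrite -(big_ord_widen _ (fun=> 1%N) rn) sum1_card card_ord.
by rewrite [RHS]big_mkcond; apply: eq_bigr => i _; rewrite ffunE; case: ifP.
Qed.

End Slices.

(** * The piecewise polynomial *)

Theorem corollary1p7 (R : realType) (k : nat) (hk : (2 <= k)%N) :
  exists p : nat -> {poly R},
    (forall (r : nat) (c : R), (r <= k - 1)%N ->
       r%:R <= c < (r + 1)%:R -> gamma k c = (p r).[c]) /\
    (forall r : nat, (1 <= r <= k - 1)%N -> p r <> p (r - 1)%N).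
Proof.
case: k hk => [|[|n]] // _.
have [P PE] := @orthant_polynomials R n.+1 isT.
pose C : R := ((n.+2`! * barnesG (1 + n.+2) ^ 2)%N%:R)^-1.
have C0 : C != 0.
  rewrite invr_eq0 pnatr_eq0 -lt0n muln_gt0 fact_gt0 expn_gt0 /= orbF.
  by apply: prodn_gt0 => i; exact: fact_gt0.
exists (fun r => C *: \sum_(S | (orthant_level S <= r)%N)
  (-1) ^+ orthant_level S *: P S).
split=> [r c _ /andP[rc cr]|r /andP[r1 rn] /eqP].
  rewrite (gamma_orthants (fun S => PE S c)) hornerZ horner_sum.
  congr (_ * _); apply: eq_big => [S|S _]; last by rewrite hornerZ.
  apply/idP/idP => [lc|lr]; last by rewrite (le_trans _ rc) // ler_nat.
  by rewrite -ltnS -(ltr_nat R) (le_lt_trans lc) // -(addn1 r).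
apply/negP; rewrite -subr_eq0 -scalerBr scaler_eq0 negb_or C0 /=.
(* p_r - p_(r-1) reduces to the terms with |S| = r, which share a sign. *)
rewrite (bigID (fun S => (orthant_level S <= r - 1)%N)) /= addrAC.
rewrite [X in X - _](eq_bigl
    (fun S => (orthant_level S <= r - 1)%N)); last first.
  by move=> S; apply/andP/idP => [[]//|lr]; split=> //; lia.
rewrite subrr add0r.
rewrite (eq_bigl (fun S => orthant_level S == r)); last by move=> S; lia.
rewrite (eq_bigr (fun S => (-1) ^+ r *: P S)); last by move=> S /eqP ->.
rewrite -scaler_sumr scaler_eq0 signr_eq0 /=.
pose c : R := \sum_(i < n.+2) (2 * i + 3)%:R.
have P1 S : 1 <= (P S).[c].
  have := orthant_polynomial_ge1 (PE S c); case: ifP => // _.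
  by rewrite ler10.
have [S0 S0r] : exists S : {ffun 'I_n.+2 -> bool}, orthant_level S = r.
  by apply: orthant_level_surj; lia.
apply/eqP => /(congr1 (horner^~ c));
  rewrite horner0 horner_sum (bigD1 S0) ?S0r //=.
apply/eqP; rewrite gt_eqF // ltr_pwDl ?(lt_le_trans ltr01) //.
by apply: sumr_ge0 => S _; rewrite (le_trans ler01).
Qed.
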